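(* Let $p\in(1,2)$. Then, for every $n\in\mathbb{N}$ with $n\ge2$, the set $F_p[-1,1]^n$ is not convex.
   Context: For a convex body $K\subset\mathbb{R}^n$ (compact convex set with non-empty interior) and $p>0$, the Fourier $p$th mean body $F_pK$ is the origin-symmetric star-shaped set $\{t\theta:\theta\in\mathbb{S}^{n-1},\,0\le t<\infty,\,t\le\rho_{F_pK}(\theta)\}$ with radial function $$\rho_{F_pK}(\theta)=\left(\frac{p}{\mathrm{Vol}_n(K)}\int_0^\infty|\widehat{\chi_K}(r\theta)|^2r^{p-1}dr\right)^{1/p},\quad\theta\in\mathbb{S}^{n-1},$$ where $\chi_K$ is the indicator function of $K$ and $\hat f(y)=\int_{\mathbb{R}^n}e^{-i\langle x,y\rangle}f(x)dx$. *)

(* Defs.v *)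
From HB Require Import structures.
From mathcomp Require Import all_boot all_order all_algebra.
From mathcomp Require Import all_classical all_reals all_analysis.
From mathcomp Require Import complex.

Set Implicit Arguments.
Unset Strict Implicit.
Unset Printing Implicit Defensive.

Import Order.TTheory GRing.Theory Num.Theory.
Import numFieldNormedType.Exports.

Local Open Scope classical_set_scope.
Local Open Scope ring_scope.
Local Open Scope complex_scope.

(* Points of R^n are row vectors 'rV[R]_n. The
   measurable structure of the library lives on n.-tuple R instead, so Lebesgue
   measure is built there and transported along row_of_tuple. *)

Section LebesgueTuple.
Context {R : realType}.
Local Notation rT := (measurableTypeR R).

Definition cons_pair n (z : rT * n.-tuple rT) : n.+1.-tuple rT :=
  [tuple of z.1 :: z.2].

Lemma measurable_cons_pair n : measurable_fun setT (@cons_pair n).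
Proof. exact: measurable_cons. Qed.

Section Step.
Variables (n : nat) (mu : {sigma_finite_measure set (n.-tuple rT) -> \bar R}).

Definition lebesgue_cons : set (n.+1.-tuple rT) -> \bar R :=
  pushforward (@lebesgue_measure R \x mu)%E (@cons_pair n).

Let lebesgue_cons0 : lebesgue_cons set0 = 0%E.
Proof. by rewrite /lebesgue_cons /pushforward preimage_set0 measure0. Qed.

Let lebesgue_cons_ge0 A : (0 <= lebesgue_cons A)%E.
Proof. by rewrite /lebesgue_cons /pushforward; exact: measure_ge0. Qed.

Let lebesgue_cons_sigma_additive : semi_sigma_additive lebesgue_cons.
Proof.
move=> F mF tF mUF; rewrite /lebesgue_cons /pushforward preimage_bigcup.
have mp A : measurable A -> measurable (@cons_pair n @^-1` A).
  by move=> mA; rewrite -[X in measurable X]setTI; exact: measurable_cons_pair.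
apply: measure_semi_sigma_additive.
- by move=> k; exact: mp.
- apply/trivIsetP => /= i j _ _ ij; rewrite -preimage_setI.
  by move/trivIsetP : tF => /(_ _ _ _ _ ij) ->//; rewrite preimage_set0.
- by rewrite -preimage_bigcup; exact: mp.
Qed.

HB.instance Definition _ := isMeasure.Build _ _ _ lebesgue_cons
  lebesgue_cons0 lebesgue_cons_ge0 lebesgue_cons_sigma_additive.

Let lebesgue_cons_sigma_finite : sigma_finite setT lebesgue_cons.
Proof.
have /sigma_finiteP[F [FT ndF Foo]] := sigma_finiteT (@lebesgue_measure R).
have /sigma_finiteP[G [GT ndG Goo]] := sigma_finiteT mu.
pose g (t : n.+1.-tuple rT) : rT * n.-tuple rT := (thead t, [tuple of behead t]).
have mg : measurable_fun setT g.
  apply/measurable_fun_pairP; split; last exact: measurable_behead.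
  exact: measurable_tnth.
exists (fun k => g @^-1` (F k `*` G k)).
  rewrite -preimage_bigcup; apply/seteqP; split => // t _.
  have [i _ Fi] : (\bigcup_i F i) (g t).1 by rewrite -FT.
  have [j _ Gj] : (\bigcup_j G j) (g t).2 by rewrite -GT.
  exists (maxn i j) => //; split.
    by apply: (subsetPset _ _ (ndF _ _ (leq_maxl i j))).
  by apply: (subsetPset _ _ (ndG _ _ (leq_maxr i j))).
move=> k; have [mFk Fkoo] := Foo k; have [mGk Gkoo] := Goo k; split.
  by rewrite -[X in measurable X]setTI; apply: mg => //; exact: measurableX.
rewrite /lebesgue_cons /pushforward -comp_preimage.
have -> : g \o @cons_pair n = id.
  apply/funext => -[x t]; rewrite /= /g /cons_pair /=; congr (_, _).
  exact/val_inj.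
rewrite preimage_id product_measure1E//.
by rewrite lte_mul_pinfty// ge0_fin_numE.
Qed.

HB.instance Definition _ := Measure_isSigmaFinite.Build _ _ _ lebesgue_cons
  lebesgue_cons_sigma_finite.

End Step.

(* The n-fold product of the one-dimensional Lebesgue measure; R^0 carries the
   unit mass at its only point. *)
Fixpoint lebesgue_tuple n : {sigma_finite_measure set (n.-tuple rT) -> \bar R} :=
  match n with
  | 0 => @dirac _ (0.-tuple rT) [tuple] R
  | m.+1 => @lebesgue_cons m (lebesgue_tuple m)
  end.

Lemma lebesgue_tuple_box n (A : 'I_n -> set rT) :
    (forall i, measurable (A i)) ->
  lebesgue_tuple n [set t | forall i, A i (tnth t i)] =
  (\prod_(i < n) lebesgue_measure (A i))%E.
Proof.
elim: n A => [|n IH] A mA.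
  by rewrite big_ord0 /= diracE mem_set// => -[].
pose B := [set t : n.-tuple rT | forall i, A (lift ord0 i) (tnth t i)].
have mB : measurable B.
  rewrite (_ : B = \bigcap_(i in [set: 'I_n])
      ((fun t : n.-tuple rT => tnth t i) @^-1` A (lift ord0 i))).
    apply: fin_bigcap_measurable => // i _.
    rewrite -[X in measurable X]setTI.
    exact: (measurable_tnth i).
  by apply/seteqP; split => t /= Bt i; [move=> _; exact: Bt|exact: Bt].
rewrite big_ord_recl -IH// -product_measure1E//=.
rewrite /lebesgue_cons /pushforward; congr (_ _).
apply/seteqP; split => -[x t] /=.
  move=> H; split; first by have := H ord0.
  by move=> i; have := H (lift ord0 i); rewrite tnthS.
move=> [/= Ax Bt] i; case: (unliftP ord0 i) => [j ->|->//].
by rewrite tnthS; exact: Bt.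
Qed.

End LebesgueTuple.
Arguments lebesgue_tuple : clear implicits.

Section FourierMeanBody.
Context {R : realType} {n : nat}.
Implicit Types (x y theta : 'rV[R]_n) (K : set 'rV[R]_n) (p : R).

Definition row_of_tuple (t : n.-tuple (measurableTypeR R)) : 'rV[R]_n :=
  \row_i tnth t i.

Definition volume K : \bar R := lebesgue_tuple R n (row_of_tuple @^-1` K).

(* Lebesgue integral of a complex-valued function, by real and imaginary
   parts. *)
Definition cintegral (g : 'rV[R]_n -> R[i]) : R[i] :=
  (\int[lebesgue_tuple R n]_t complex.Re (g (row_of_tuple t))) +i*
  (\int[lebesgue_tuple R n]_t complex.Im (g (row_of_tuple t))).

Definition dotp x y : R := \sum_(i < n) x ord0 i * y ord0 i.

(* The norm `|x| of the library on 'rV[R]_n is the sup norm. *)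
Definition unit_sphere : set 'rV[R]_n :=
  [set theta | Num.sqrt (dotp theta theta) = 1].

(* e^(it) *)
Definition cis (t : R) : R[i] := cos t +i* sin t.

Definition fourier (f : 'rV[R]_n -> R[i]) y : R[i] :=
  cintegral (fun x => cis (- dotp x y) * f x).

Definition chi K x : R[i] := (\1_K x)%:C.

(* Values in \bar R: the integral may diverge, in which case the radial
   function is +oo. *)
Definition radial_Fourier_mean_body p K theta : \bar R :=
  poweR ((p / fine (volume K))%:E *
         \int[lebesgue_measure]_(r in `]0%R, +oo[)
           (ComplexField.Normc.normc (fourier (chi K) (r *: theta)) ^+ 2
              * r `^ (p - 1))%:E)%E p^-1.

Definition Fourier_mean_body p K : set 'rV[R]_n :=
  [set x | exists t theta, [/\ unit_sphere theta, 0 <= t,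
     (t%:E <= radial_Fourier_mean_body p K theta)%E & x = t *: theta]].

End FourierMeanBody.

Definition cube (R : realType) (n : nat) : set 'rV[R]_n :=
  [set x | forall i, x ord0 i \in `[(- 1), 1]].
Arguments cube : clear implicits.

(* Main.v *)
(* The transform of the cube is a product of sinc functions, so on the
   plane spanned by the first two axes the p-th power of the radial function is,
   up to a constant, the (-p)-homogeneous function
     J(a, b) = int_0^oo sinc(ra)^2 sinc(rb)^2 r^(p-1) dr,
   and J(1, 0) < oo because p < 2. Since 1 - sinc(ru)^2 >= 3/4 as soon as
   ru >= 2, and the integrand of J(1, 0) is sin(r)^2 r^(p-3), the difference
   J(1, 0) - J(1, u) is at least of order u^(2-p) when u -> 0: as p > 1 the
   boundary has an outward cusp on each axis. If the body were convex, the chord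
   joining its boundary points on the first two axes would give
   J(1, 0) <= (1 + u)^p J(1, u), a difference of order u only. *)
Require Import Defs.
From mathcomp Require Import all_boot all_order all_algebra.
From mathcomp Require Import all_classical all_reals all_analysis.
From mathcomp Require Import measurable_realfun complex ring lra.

Set Implicit Arguments.
Unset Strict Implicit.
Unset Printing Implicit Defensive.

Import Order.TTheory GRing.Theory Num.Theory.
Import numFieldNormedType.Exports.
Local Open Scope classical_set_scope.
Local Open Scope ring_scope.

(** * One-variable analysis: sinc, trigonometric integrals, powers, scaling of the line *)

Section Kernel.
Context {R : realType}.
Implicit Types (a b x y : R) (f F : R -> R).
Local Notation mu := (@lebesgue_measure R).

Lemma integral_is_derive f F a b : a < b -> continuous f ->
    (forall x, is_derive x 1 F (f x)) ->
  (\int[mu]_(x in `[a, b]) (f x)%:E = (F b - F a)%:E)%E.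
Proof.
move=> ab cf dF; rewrite EFinB; apply: continuous_FTC2 => //.
- exact: continuous_subspaceT.
- have cF : continuous F.
    by move=> x; apply/differentiable_continuous/derivable1_diffP; case: (dF x).
  split; first by move=> x _; case: (dF x).
  + exact/cvg_at_right_filter/cF.
  + exact/cvg_at_left_filter/cF.
- by move=> x _; rewrite derive1E derive_val.
Qed.

(** The value 1 at 0 is the limit there; it makes [integral_cos] valid at frequency 0, hence at
    points with vanishing coordinates. *)
Definition sinc x : R := if x == 0 then 1 else sin x / x.

Lemma sincN x : sinc (- x) = sinc x.
Proof. by rewrite /sinc oppr_eq0 sinN invrN mulrNN. Qed.

Lemma sinc0 : sinc 0 = 1. Proof. by rewrite /sinc eqxx. Qed.

Lemma sincE x : x != 0 -> sinc x = sin x / x.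
Proof. by rewrite /sinc => /negPf ->. Qed.

(** By the mean value theorem [sin x = cos c * x] for some [c]; evenness reduces to [x > 0]. *)
Lemma sinc_max x : `|sinc x| <= 1.
Proof.
wlog x0 : x / 0 < x => [h|].
  have [x0|x0|->] := ltgtP x 0; last by rewrite sinc0 normr1.
  - by rewrite -sincN h// oppr_gt0.
  - exact: h.
have [c _] := @MVT R sin cos 0 x x0 (fun y _ => is_derive_sin y)
  (continuous_subspaceT (@continuous_sin R)).
rewrite sin0 !subr0 sincE ?gt_eqF// => ->.
by rewrite mulfK ?gt_eqF// cos_max.
Qed.

Lemma measurable_sinc : measurable_fun setT sinc.
Proof.
apply: measurable_fun_if => //; first exact: measurable_fun_eqr.
rewrite setTI (_ : _ @^-1` _ = ~` [set 0]); last first.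
  by apply/seteqP; split => x /=; [move/eqP|move/eqP/negPf].
apply: open_continuous_measurable_fun.
  by rewrite openC; exact: closed_eq.
move=> x; rewrite inE/= => /eqP x0; apply: cvgM; first exact: continuous_sin.
exact: cvgV.
Qed.

Lemma is_derive_compM f (df : R -> R) y x : (forall z : R, is_derive z 1 f (df z)) ->
  is_derive x 1 (fun x => f (y * x)) (y * df (y * x)).
Proof.
move=> dF; have dy : is_derive x 1 ( *%R y) y.
  by apply: is_derive_eq; rewrite /= ?scaler1 ?scale0r ?mulr1 ?addr0.
have := @is_derive1_comp _ f ( *%R y) x _ _ (dF _) dy.
by rewrite mulrC.
Qed.

Lemma integral_cos y : (\int[mu]_(x in `[(-1)%R, 1%R]) (cos (y * x))%:E = (2 * sinc y)%:E)%E.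
Proof.
have [->|y0] := eqVneq y 0.
  rewrite sinc0; under eq_integral do rewrite mul0r cos0.
  rewrite integral_cst//= mul1e lebesgue_measure_itv/= lte_fin ifT; last by lra.
  by rewrite -EFinB; congr EFin; lra.
pose F x := y^-1 * sin (y * x).
have dF x : is_derive x 1 F (cos (y * x)).
  have d1 := @is_derive_compM sin cos y x (@is_derive_sin R).
  by apply: is_derive_eq; rewrite -[_ *: _]/(_ * _) mulKf.
rewrite (integral_is_derive (F := F)).
- by rewrite /F sincE// mulr1 mulrN1 sinN; congr EFin; field.
- lra.
- by move=> x; apply: continuous_comp; [exact: mulrl_continuous|exact: continuous_cos].
Qed.

Lemma integral_sin y : (\int[mu]_(x in `[(-1)%R, 1%R]) (sin (y * x))%:E = 0)%E.
Proof.
have [->|y0] := eqVneq y 0.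
  by under eq_integral do rewrite mul0r sin0; rewrite integral0.
pose F x := - (y^-1 * cos (y * x)).
have dF x : is_derive x 1 F (sin (y * x)).
  have d1 := @is_derive_compM cos (fun x => - sin x) y x (@is_derive_cos R).
  by apply: is_derive_eq; rewrite -[_ *: _]/(_ * _) mulKf ?opprK.
rewrite (integral_is_derive (F := F)).
- by rewrite /F mulr1 mulrN1 cosN subrr.
- lra.
- by move=> x; apply: continuous_comp; [exact: mulrl_continuous|exact: continuous_sin].
Qed.

Lemma integral_sin_sqr a b : a < b ->
  (\int[mu]_(x in `[a, b]) (sin x ^+ 2)%:E =
   (2^-1 * (b - sin b * cos b) - 2^-1 * (a - sin a * cos a))%:E)%E.
Proof.
move=> ab.
pose F x := 2^-1 * (x - sin x * cos x).
have dF x : is_derive x 1 F (sin x ^+ 2).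
  apply: is_derive_eq; rewrite /GRing.scale/=.
  by have := cos2Dsin2 x; lra.
rewrite (integral_is_derive (F := F))//.
by move=> x; apply: cvgM; exact: continuous_sin.
Qed.

(** Expand [(sin x + cos x)^2 >= 0] and [(sin x - cos x)^2 >= 0]. *)
Lemma sin_cos_max x : `|sin x * cos x| <= 2^-1.
Proof.
have := sqr_ge0 (sin x + cos x); have := sqr_ge0 (sin x - cos x).
by have := cos2Dsin2 x; rewrite ler_norml; lra.
Qed.

(** The main term of the antiderivative gives [T / 2]; the two boundary terms cost at most 1/4 each,
    and [T / 2 - 1 / 2 >= T / 4] once [T >= 2]. *)
Lemma integral_sin_sqr_ge (T : R) : 2 <= T ->
  ((T / 4)%:E <= \int[mu]_(x in `[T, (T + T)%R]) (sin x ^+ 2)%:E)%E.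
Proof.
move=> T2; rewrite integral_sin_sqr; last lra.
rewrite lee_fin.
have := sin_cos_max T; have := sin_cos_max (T + T).
rewrite !ler_norml => /andP[? ?] /andP[? ?]; lra.
Qed.

Lemma powR_cvgy (q : R) : q < 0 -> x `^ q @[x --> +oo] --> (0 : R).
Proof.
move=> q0; apply/cvgrPdist_le => e e0; near=> x.
rewrite sub0r normrN ger0_norm ?powR_ge0//.
have x0 : 0 < x by near: x; exact: nbhs_pinfty_gt.
(* The threshold for [x] is [e^(1/q)]. As [q < 0], monotonicity is applied to the power [- q] and
   then inverted. *)
have eE : e = (e `^ q^-1) `^ q by rewrite -powRrM mulVf ?ltr0_neq0// powRr1// ltW.
have qE y : y `^ q = (y `^ (- q))^-1 by rewrite powRN invrK.
rewrite eE !qE lef_pV2 ?posrE ?powR_gt0//.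
rewrite ge0_ler_powR ?nnegrE ?powR_ge0 ?ltW//; lra.
Unshelve. all: by end_near. Qed.

Lemma integral_powR_tail (q : R) : q < -1 ->
  (\int[mu]_(x in `[1%R, +oo[) (x `^ q)%:E = (- (q + 1)^-1)%:E)%E.
Proof.
move=> q1; pose F x := (q + 1)^-1 * x `^ (q + 1).
have dF x : 0 < x -> is_derive x 1 F (x `^ q).
  move=> x0; have := is_derive1_powR (q + 1) x0 => ?.
  by apply: is_derive_eq; rewrite /GRing.scale/= mulKf ?addrK//; lra.
rewrite (@ge0_continuous_FTC2y _ _ F _ 0).
- by rewrite /F powR1 mulr1 -EFinB sub0r.
- by move=> x _; exact: powR_ge0.
- apply: derivable_within_continuous => x; rewrite in_itv/= andbT => x1.
  by apply: derivable_powR; rewrite in_itv/= andbT; lra.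
- by rewrite -[0](mulr0 (q + 1)^-1); apply: cvgMr; apply: powR_cvgy; lra.
- by move=> x x1; case: (dF x); first lra.
- apply/cvg_at_right_filter/differentiable_continuous/derivable1_diffP.
  by case: (dF 1); first lra.
- move=> x; rewrite in_itv/= andbT => x1; rewrite derive1E.
  have ? : is_derive x 1 F (x `^ q) by apply: dF; lra.
  by rewrite derive_val.
Qed.

Lemma measurable_mull (l : R) : measurable_fun setT ( *%R l : R -> measurableTypeR R).
Proof. exact: measurable_funM. Qed.

(** Lebesgue measure is determined by its values on half-open intervals, and the preimage of []a,
    b]] is []a/l, b/l]], whose length the weight [l] restores. *)
Lemma lebesgue_measure_scale (l : {posnum R}) (A : set R) : measurable A ->
  pushforward (mscale (l%:num%:nng) mu) ( *%R l%:num : R -> measurableTypeR R) A = mu A.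
Proof.
have ml := measurable_mull l%:num.
move=> mA; apply/esym/lebesgue_measure_unique => //= _ [[a b]] _ <-.
rewrite /mscale/= /pushforward.
rewrite (_ : _ @^-1` _ = `](a / l%:num), (b / l%:num)]%classic).
  rewrite !lebesgue_measure_itv/= !lte_fin ltr_pM2r//.
  case: ifP => _; last by rewrite mule0.
  by rewrite -!EFinB -EFinM; congr EFin; field.
by apply/seteqP; split => x /=; rewrite !in_itv/= ltr_pdivrMr// ler_pdivlMr// mulrC.
Qed.

Lemma ge0_integral_scale (l : R) (f : R -> \bar R) : 0 < l ->
  measurable_fun setT f -> (forall x, 0 <= f x)%E ->
  (\int[mu]_(x in `]0%R, +oo[) f x =
   l%:E * \int[mu]_(x in `]0%R, +oo[) f (l * x)%R)%E.
Proof.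
move=> l0 mf f0; pose L := PosNum l0.
have mL := measurable_mull l.
transitivity (\int[pushforward (mscale (L%:num%:nng)%R mu)
    ( *%R l : R -> measurableTypeR R)]_(x in `]0%R, +oo[) f x)%E.
  by apply: eq_measure_integral => A mA _; exact/esym/(lebesgue_measure_scale L).
rewrite ge0_integral_pushforward//; last exact: measurable_funTS.
rewrite (_ : _ @^-1` _ = `]0, +oo[%classic); last first.
  by apply/seteqP; split => x /=; rewrite !in_itv/= !andbT pmulr_rgt0.
rewrite ge0_integral_mscale//.
- by apply: measurable_funTS; exact: measurableT_comp.
- by move=> x _; exact: f0.
Qed.

End Kernel.

(** * Fubini for products of functions, and its transport to tuples *)

Section TupleFubini.
Context {R : realType}.
Local Notation mu := (@lebesgue_measure R).
Local Notation rT := (measurableTypeR R).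

Lemma integrable_prodM d1 d2 (T1 : measurableType d1) (T2 : measurableType d2)
    (m1 : {sigma_finite_measure set T1 -> \bar R})
    (m2 : {sigma_finite_measure set T2 -> \bar R}) (f : T1 -> R) (g : T2 -> R) :
  m1.-integrable setT (EFin \o f) -> m2.-integrable setT (EFin \o g) ->
  (m1 \x m2)%E.-integrable setT (fun z => (f z.1 * g z.2)%:E).
Proof.
move=> intf intg; have /integrableP[mf f_lty] := intf.
have /integrableP[mg g_lty] := intg.
have {}mf : measurable_fun setT f by exact/measurable_EFinP.
have {}mg : measurable_fun setT g by exact/measurable_EFinP.
apply/integrable12ltyP.
  apply/measurable_EFinP; apply: measurable_funM.
    exact: (measurableT_comp mf).
  exact: (measurableT_comp mg).
under eq_integral => x _.
  under eq_integral do rewrite /= normrM EFinM.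
  rewrite ge0_integralZl//; last first.
    by apply/measurable_EFinP; exact: measurableT_comp.
  over.
rewrite ge0_integralZr//; last 2 first.
- by apply/measurable_EFinP; exact: measurableT_comp.
- exact: integral_ge0.
by apply: lte_mul_pinfty => //; rewrite ?ge0_fin_numE// integral_ge0.
Qed.

Lemma integral_prodM d1 d2 (T1 : measurableType d1) (T2 : measurableType d2)
    (m1 : {sigma_finite_measure set T1 -> \bar R})
    (m2 : {sigma_finite_measure set T2 -> \bar R}) (f : T1 -> R) (g : T2 -> R) :
  m1.-integrable setT (EFin \o f) -> m2.-integrable setT (EFin \o g) ->
  (\int[m1 \x m2]_z (f z.1 * g z.2)%:E =
   (\int[m1]_x (f x)%:E) * (\int[m2]_y (g y)%:E))%E.
Proof.
move=> intf intg; rewrite -integral12_prod_meas1; last exact: integrable_prodM.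
under eq_integral => x _.
  rewrite /fubini_F; under eq_integral do rewrite /= EFinM.
  rewrite integralZl//.
  over.
have /fineK <- : (\int[m2]_y (g y)%:E)%E \is a fin_num by exact: integrable_fin_num.
by rewrite integralZr.
Qed.

Section Cons.
Variables (n : nat) (f : rT -> R) (g : n.-tuple rT -> R).
Hypotheses (intf : mu.-integrable setT (EFin \o f))
  (intg : (lebesgue_tuple R n).-integrable setT (EFin \o g)).

Let h (t : n.+1.-tuple rT) := (f (thead t) * g [tuple of behead t])%:E.

Let measurable_h : measurable_fun setT h.
Proof.
have /integrableP[/measurable_EFinP mf _] := intf.
have /integrableP[/measurable_EFinP mg _] := intg.
apply/measurable_EFinP; apply: measurable_funM.
  by apply: (measurableT_comp mf); exact: measurable_tnth.
by apply: (measurableT_comp mg); exact: measurable_behead.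
Qed.

Let h_cons : h \o @cons_pair R n = (fun z => (f z.1 * g z.2)%:E).
Proof.
apply/funext => -[x t]; rewrite /h /= /cons_pair/= theadE.
by congr (_ * g _)%:E; exact/val_inj.
Qed.

(** The measure on [n.+1]-tuples is by construction the pushforward of a product measure under
    [cons_pair], and [h] pulls back to a product of functions of separate variables. *)
Lemma integrable_tuple_cons : (lebesgue_tuple R n.+1).-integrable setT h.
Proof.
apply: integrable_pushforward => //; first exact: measurable_cons_pair.
by rewrite preimage_setT h_cons; exact: integrable_prodM.
Qed.

Lemma integral_tuple_cons :
  (\int[lebesgue_tuple R n.+1]_t h t =
   (\int[mu]_x (f x)%:E) * (\int[lebesgue_tuple R n]_t (g t)%:E))%E.
Proof.
rewrite [LHS]integral_pushforward//; first last.
- by rewrite preimage_setT h_cons; exact: integrable_prodM.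
- exact: measurable_cons_pair.
by rewrite preimage_setT h_cons integral_prodM.
Qed.

End Cons.
End TupleFubini.

(** * Volume and Fourier transform of the cube *)

Section CubeTransform.
Context {R : realType}.
Local Notation mu := (@lebesgue_measure R).
Local Notation rT := (measurableTypeR R).
Local Notation I := `[(-1)%R, 1%R]%classic.

Lemma integrable_segment (f : R -> R) : continuous f ->
  mu.-integrable setT (EFin \o (fun x => f x * \1_(I : set R) x)).
Proof.
move=> cf.
rewrite (_ : EFin \o _ = (EFin \o f) \_ I).
  apply/integrable_restrict => //; rewrite setTI.
  apply: continuous_compact_integrable; first exact: segment_compact.
  exact: continuous_subspaceT.
apply/funext => x; rewrite /= patchE indicE.
by case: ifPn; rewrite ?mulr1 ?mulr0.
Qed.

Lemma integral_segment (f : R -> R) :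
  (\int[mu]_x (f x * \1_(I : set R) x)%:E = \int[mu]_(x in I) (f x)%:E)%E.
Proof.
rewrite [RHS]integral_mkcond; apply: eq_integral => x _.
by rewrite patchE indicE; case: ifPn; rewrite ?mulr1 ?mulr0.
Qed.

Definition cubebox n (t : n.-tuple rT) : R := \prod_(i < n) \1_(I : set R) (tnth t i).
Definition phase n (y : 'I_n -> R) (t : n.-tuple rT) : R :=
  \sum_(i < n) tnth t i * y i.

Lemma tnth_behead_lift n T (t : n.+1.-tuple T) i :
  tnth [tuple of behead t] i = tnth t (lift ord0 i).
Proof.
by rewrite tnth_behead; congr tnth; apply/val_inj; rewrite /= inordK ?ltnS.
Qed.

Lemma cubeboxS n (t : n.+1.-tuple rT) :
  cubebox t = \1_(I : set R) (thead t) * cubebox [tuple of behead t].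
Proof.
rewrite /cubebox big_ord_recl; congr (_ * _); apply: eq_bigr => i _.
by rewrite tnth_behead_lift.
Qed.

Lemma phaseS n (y : 'I_n.+1 -> R) (t : n.+1.-tuple rT) :
  phase y t = thead t * y ord0 + phase (y \o lift ord0) [tuple of behead t].
Proof.
rewrite /phase big_ord_recl; congr (_ + _); apply: eq_bigr => i _.
by rewrite tnth_behead_lift.
Qed.

(** The angle addition formulas split off the first coordinate but mix cosine and sine, so both
    integrals go through one induction, along with the integrability that Fubini requires. Every
    term with a sine factor integrates to 0, which leaves the product of the cosine integrals. *)
Lemma integral_trig_box n (y : 'I_n -> R) :
  [/\ (lebesgue_tuple R n).-integrable setT
        (EFin \o (fun t => cos (phase y t) * cubebox t)),
      (lebesgue_tuple R n).-integrable setT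
        (EFin \o (fun t => sin (phase y t) * cubebox t)),
      (\int[lebesgue_tuple R n]_t (cos (phase y t) * cubebox t)%:E =
       (\prod_(i < n) (2 * sinc (y i)))%:E)%E &
      (\int[lebesgue_tuple R n]_t (sin (phase y t) * cubebox t)%:E = 0)%E].
Proof.
elim: n y => [|n IH] y.
  (* In dimension 0 the measure is a unit mass, the phase is an empty sum and the box an empty
     product: the integrals are 1 and 0. *)
  have cst_int (c : R) : (lebesgue_tuple R 0).-integrable setT (EFin \o cst c).
    apply/integrableP; split; first exact/measurable_EFinP/measurable_cst.
    by rewrite (integral_cst _ measurableT `|c|%:E)/= diracT mule1 ltry.
  have cosE t : cos (phase y t) * cubebox t = 1.
    by rewrite /phase /cubebox !big_ord0 cos0 mulr1.
  have sinE t : sin (phase y t) * cubebox t = 0.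
    by rewrite /phase /cubebox !big_ord0 sin0 mul0r.
  rewrite (funext cosE) (funext sinE).
  split; [exact: cst_int|exact: cst_int| |].
  + under eq_integral do rewrite cosE.
    by rewrite (integral_cst _ measurableT 1%:E)/= diracT mule1 big_ord0.
  + by under eq_integral do rewrite sinE; rewrite integral0.
pose y' := y \o lift ord0; pose z := y ord0.
have [IHci IHsi IHc IHs] := IH y'.
pose c1 x := cos (z * x) * \1_(I : set R) x.
pose s1 x := sin (z * x) * \1_(I : set R) x.
pose cn t := cos (phase y' t) * cubebox t.
pose sn t := sin (phase y' t) * cubebox t.
have ci : mu.-integrable setT (EFin \o c1).
  apply: integrable_segment => x.
  by apply: continuous_comp; [exact: mulrl_continuous|exact: continuous_cos].
have si : mu.-integrable setT (EFin \o s1).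
  apply: integrable_segment => x.
  by apply: continuous_comp; [exact: mulrl_continuous|exact: continuous_sin].
have icc := integrable_tuple_cons ci IHci.
have iss := integrable_tuple_cons si IHsi.
have ics := integrable_tuple_cons ci IHsi.
have isc := integrable_tuple_cons si IHci.
have cosE t : ((cos (phase y t) * cubebox t)%:E =
    (c1 (thead t) * cn [tuple of behead t])%:E -
    (s1 (thead t) * sn [tuple of behead t])%:E)%E.
  rewrite -EFinB phaseS cubeboxS cosD -/z -/y' [_ * z]mulrC.
  by congr EFin; rewrite /c1 /s1 /cn /sn; ring.
have sinE t : ((sin (phase y t) * cubebox t)%:E =
    (s1 (thead t) * cn [tuple of behead t])%:E +
    (c1 (thead t) * sn [tuple of behead t])%:E)%E.
  rewrite -EFinD phaseS cubeboxS sinD -/z -/y' [_ * z]mulrC.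
  by congr EFin; rewrite /c1 /s1 /cn /sn; ring.
split.
- rewrite -[X in integrable _ _ X]/(fun t => (cos (phase y t) * cubebox t)%:E).
  by rewrite (funext cosE); exact: integrableB.
- rewrite -[X in integrable _ _ X]/(fun t => (sin (phase y t) * cubebox t)%:E).
  by rewrite (funext sinE); exact: integrableD.
- under eq_integral do rewrite cosE.
  rewrite integralB// (integral_tuple_cons ci IHci) (integral_tuple_cons si IHsi).
  rewrite !integral_segment integral_cos integral_sin mul0e sube0 IHc.
  by rewrite -EFinM big_ord_recl.
- under eq_integral do rewrite sinE.
  rewrite integralD// (integral_tuple_cons si IHci) (integral_tuple_cons ci IHsi).
  by rewrite !integral_segment integral_sin IHs mul0e mule0 adde0.
Qed.

Lemma cube_row_of_tuple n (t : n.-tuple rT) :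
  \1_(cube R n) (row_of_tuple t) = cubebox t.
Proof.
rewrite indicE /cubebox; have [|] := boolP (row_of_tuple t \in cube R n).
  rewrite inE => tc; rewrite big1// => i _; rewrite indicE mem_set//=.
  by have := tc i; rewrite mxE.
rewrite notin_setE => ntc.
have /existsNP[i ti] : ~ forall i, tnth t i \in `[(- 1)%R, 1%R].
  by move=> tc; apply: ntc => i; rewrite mxE; exact: tc.
by rewrite (bigD1 i)//= indicE memNset//= mul0r.
Qed.

Lemma volume_cube n : volume (cube R n) = ((2 : R) ^+ n)%:E.
Proof.
rewrite /volume.
rewrite (_ : _ @^-1` _ = [set t | forall i, (I : set R) (tnth t i)]).
  rewrite (lebesgue_tuple_box (A := fun=> (I : set R)))//.
  under eq_bigr do rewrite lebesgue_measure_itv/= lte_fin.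
  rewrite ifT; last by lra.
  by rewrite -EFinB prodEFin prodr_const card_ord opprK.
by apply/seteqP; split => t /= tc i; have := tc i; rewrite /= mxE.
Qed.

Lemma fourier_cube n (y : 'rV[R]_n) :
  fourier (chi (cube R n)) y = ((\prod_(i < n) (2 * sinc (y ord0 i)))%:C)%C.
Proof.
have [_ si cE sE] := integral_trig_box (fun i => y ord0 i).
rewrite /fourier /cintegral.
have dotpE t : dotp (row_of_tuple t) y = phase (fun i => y ord0 i) t.
  by apply: eq_bigr => i _; rewrite mxE.
congr (_ +i* _)%C.
  (* The kernel is [e^(-i<x,y>)]: the sign is absorbed by the even cosine here, and below it only
     negates a sine integral equal to 0. *)
  rewrite /Rintegral -[RHS]/(fine _%:E) -cE; congr fine; apply: eq_integral => t _.
  by rewrite /chi cube_row_of_tuple /= dotpE cosN mulr0 subr0.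
rewrite /Rintegral.
transitivity (fine (\int[lebesgue_tuple R n]_t
    - (sin (phase (fun i => y ord0 i) t) * cubebox t)%:E))%E.
  congr fine; apply: eq_integral => t _.
  by rewrite /chi cube_row_of_tuple /= dotpE sinN mulr0 add0r mulNr.
rewrite integralN/= ?sE ?oppe0//.
exact: integrable_add_def.
Qed.

End CubeTransform.

(** * The planar integral J: homogeneity, finiteness, and the gap at the axis *)

Section Planar.
Context {R : realType}.
Variable p : R.
Local Notation mu := (@lebesgue_measure R).
Implicit Types a b l r T : R.

Definition planar_integrand a b r : R :=
  sinc (r * a) ^+ 2 * sinc (r * b) ^+ 2 * r `^ (p - 1).

(** Kept in [\bar R] because it can diverge: at [a = b = 0] the integrand is a bare power. *)
Definition planar_integral a b : \bar R :=
  (\int[mu]_(r in `]0%R, +oo[) (planar_integrand a b r)%:E)%E.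

Lemma sincX2_le1 r : sinc r ^+ 2 <= 1.
Proof. by rewrite -real_normK ?num_real// expr_le1// sinc_max. Qed.

Lemma planar_integrand_ge0 a b r : 0 <= planar_integrand a b r.
Proof.
apply: mulr_ge0; last exact: powR_ge0.
by apply: mulr_ge0; exact: sqr_ge0.
Qed.

Lemma measurable_planar_integrand a b : measurable_fun setT (planar_integrand a b).
Proof.
have ms c : measurable_fun setT (fun r : R => sinc (r * c) ^+ 2).
  apply: measurable_funX; apply: (measurableT_comp measurable_sinc).
  exact: measurable_funM.
by apply: measurable_funM; [exact: measurable_funM|exact: measurable_powR].
Qed.

Lemma planar_integral_ge0 a b : (0 <= planar_integral a b)%E.
Proof. by apply: integral_ge0 => r _; rewrite lee_fin planar_integrand_ge0. Qed.

Lemma planar_integralC a b : planar_integral a b = planar_integral b a.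
Proof.
by apply: eq_integral => r _; rewrite /planar_integrand [_ ^+ 2 * _ ^+ 2]mulrC.
Qed.

(** Substitute [l * r] for [r]: the differential contributes [l] and the weight [l^(p-1)]. This
    (-p)-homogeneity allows any multiple of a unit vector as a direction. *)
Lemma planar_integralZ l a b : 0 < p -> 0 < l ->
  (planar_integral a b = (l `^ p)%:E * planar_integral (l * a) (l * b))%E.
Proof.
move=> p0 l0; rewrite /planar_integral.
rewrite (ge0_integral_scale (f := fun r => (planar_integrand a b r)%:E) l0).
- rewrite -mulr_powRB1 ?ltW//.
  rewrite EFinM -muleA; congr (_ * _)%E.
  rewrite -ge0_integralZl//=.
  + apply: eq_integral => r; rewrite inE/= in_itv/= andbT => r0.
    rewrite -EFinM; congr EFin.
    rewrite /planar_integrand powRM ?ltW// (mulrAC l r a) (mulrAC l r b).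
    by rewrite [r * (l * a)]mulrC [r * (l * b)]mulrC; ring.
  + by apply/measurable_EFinP/measurable_funTS; exact: measurable_planar_integrand.
  + by move=> r _; rewrite lee_fin planar_integrand_ge0.
  + by rewrite lee_fin powR_ge0.
- by apply/measurable_EFinP; exact: measurable_planar_integrand.
- by move=> r; rewrite lee_fin planar_integrand_ge0.
Qed.

Lemma planar_integrand10 r : 0 < r ->
  planar_integrand 1 0 r = sin r ^+ 2 * r `^ (p - 3).
Proof.
move=> r0; rewrite /planar_integrand mulr0 sinc0 expr1n !mulr1 sincE ?gt_eqF//.
rewrite (_ : p - 1 = p - 3 + 2%:R); last by lra.
rewrite powRD; last by apply/implyP => _; rewrite gt_eqF.
rewrite powR_mulrn ?ltW//; field; exact: lt0r_neq0.
Qed.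

(** Split at 1. Below, the integrand is at most 1 because [p > 1]; above, it is at most [r^(p-3)],
    which is integrable because [p < 2]. *)
Lemma planar_integral10_lty : 1 < p < 2 -> (planar_integral 1 0 < +oo)%E.
Proof.
move=> /andP[p_gt1 p_lt2].
have mJ : measurable_fun setT (fun r => (planar_integrand 1 0 r)%:E).
  by apply/measurable_EFinP; exact: measurable_planar_integrand.
rewrite /planar_integral (_ : `]0, +oo[%classic = `]0, 1[ `|` `[1, +oo[); last first.
  apply/seteqP; split => r /=; rewrite !in_itv/= !andbT.
    by move=> ->; case: ltP; [left|right].
  by case => [/andP[]//|]; exact: lt_le_trans.
rewrite ge0_integral_setU//=; last 3 first.
- exact: measurable_funTS.
- by move=> r _; rewrite lee_fin planar_integrand_ge0.
- apply/disj_setPS => r /=; rewrite !in_itv/= andbT => -[/andP[_ r1] /(lt_le_trans r1)].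
  by rewrite ltxx.
apply: lte_add_pinfty.
  apply: (@le_lt_trans _ _ (\int[mu]_(r in `]0%R, 1%R[) 1%:E)%E).
    apply: ge0_le_integral => //.
    - by move=> r _; rewrite lee_fin planar_integrand_ge0.
    - exact: measurable_funTS.
    - move=> r /=; rewrite in_itv/= lee_fin => /andP[r0 r1].
      rewrite /planar_integrand mulr0 sinc0 expr1n !mulr1.
      rewrite mulr_ile1 ?sqr_ge0 ?powR_ge0 ?sincX2_le1//.
      by rewrite -[leRHS](powRr0 r) ger_powR ?r0 ?(ltW r1)// subr_ge0 ltW.
  by rewrite integral_cst//= lebesgue_measure_itv/= lte_fin ltr01 -EFinB -EFinM ltry.
apply: (@le_lt_trans _ _ (\int[mu]_(r in `[1%R, +oo[) (r `^ (p - 3))%:E)%E).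
  apply: ge0_le_integral => //.
  - by move=> r _; rewrite lee_fin planar_integrand_ge0.
  - exact: measurable_funTS.
  - by apply/measurable_EFinP/measurable_funTS; exact: measurable_powR.
  - move=> r /=; rewrite in_itv/= andbT lee_fin => r1.
    rewrite planar_integrand10 ?(lt_le_trans ltr01)// ler_piMl ?powR_ge0//.
by rewrite integral_powR_tail ?ltry//; lra.
Qed.

(** With [u = 2 / T], the loss is the integral of [(1 - sinc(r u)^2) * sin(r)^2 * r^(p-3)]. On
    [[T, 2T]] one has [r u >= 2], so the first factor is at least 3/4, the power is at least
    [(2T)^(p-3)], and the squared sine integrates to at least [T / 4]. Writing the gap as a sum
    avoids subtracting extended reals. *)
Lemma planar_integral_gap T : p < 2 -> 2 <= T ->
  (planar_integral 1 (2 / T) + (3 / 16 * T * (T + T) `^ (p - 3))%:E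
   <= planar_integral 1 0)%E.
Proof.
move=> p_lt2 T2; pose c : R := 3 / 4 * (T + T) `^ (p - 3).
have c0 : 0 <= c by rewrite mulr_ge0 ?powR_ge0//; lra.
(* [g] is a minorant of the loss, supported on the window [D]; the claim becomes a pointwise
   inequality between integrands. *)
pose D : set R := `[T, T + T]%classic.
have mD : measurable D by exact: measurable_itv.
pose g r : R := c * sin r ^+ 2 * \1_D r.
have g0 r : 0 <= g r by rewrite mulr_ge0// mulr_ge0// sqr_ge0.
have mJ a b (E : set R) : measurable_fun E (fun r => (planar_integrand a b r)%:E).
  by apply/measurable_EFinP/measurable_funTS; exact: measurable_planar_integrand.
have msin : measurable_fun setT (fun r : R => sin r ^+ 2).
  apply: measurable_funX.
  by apply: continuous_measurable_fun; exact: continuous_sin.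
have mg : measurable_fun setT (fun r => (g r)%:E).
  apply/measurable_EFinP; apply: measurable_funM.
    exact: measurable_funM.
  exact: measurable_indic.
apply: (@le_trans _ _
  (planar_integral 1 (2 / T) + \int[mu]_(r in `]0%R, +oo[) (g r)%:E)%E).
  rewrite leeD2l//.
  apply: (@le_trans _ _ (\int[mu]_(r in D) (g r)%:E)%E); last first.
    apply: ge0_subset_integral => //.
    - exact: measurable_funTS.
    - by move=> r _; rewrite lee_fin.
    - by move=> r; rewrite /D/= !in_itv/= andbT => /andP[Tr _]; lra.
  have -> : (\int[mu]_(r in D) (g r)%:E =
             \int[mu]_(r in D) (c%:E * (sin r ^+ 2)%:E))%E.
    by apply: eq_integral => r rD; rewrite /g indicE rD mulr1 EFinM.
  rewrite ge0_integralZl//=; last 2 first.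
  - exact/measurable_EFinP/measurable_funTS.
  - by move=> r _; rewrite lee_fin sqr_ge0.
  - apply: le_trans (lee_wpmul2l _ (integral_sin_sqr_ge T2)); last by rewrite lee_fin.
    by rewrite -EFinM lee_fin /c; lra.
have J0 a b r : (0 <= (planar_integrand a b r)%:E)%E.
  by rewrite lee_fin planar_integrand_ge0.
rewrite /planar_integral -ge0_integralD//=; last 3 first.
- exact: mJ.
- by move=> r _; rewrite lee_fin.
- exact: measurable_funTS.
apply: ge0_le_integral => //=.
- by move=> r _; rewrite adde_ge0// lee_fin.
- by apply: emeasurable_funD; [exact: mJ|exact: (measurable_funTS mg)].
- exact: mJ.
move=> r; rewrite in_itv/= andbT -EFinD lee_fin => r0.
have -> : planar_integrand 1 (2 / T) r =
    sinc (r * (2 / T)) ^+ 2 * planar_integrand 1 0 r.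
  by rewrite /planar_integrand !mulr0 sinc0 expr1n mulr1; ring.
rewrite /g indicE; case: (boolP (r \in D)) => [|_]; last first.
  by rewrite mulr0 addr0 ler_piMl ?planar_integrand_ge0 ?sincX2_le1.
rewrite inE /D/= in_itv/= => /andP[Tr rT]; rewrite mulr1.
have T0 : 0 < T by lra.
(* The exponent [p - 3] is negative, so the power is smallest at the right end of the window. *)
have cr : (T + T) `^ (p - 3) <= r `^ (p - 3).
  have pE y : y `^ (p - 3) = (y `^ (3 - p))^-1 by rewrite -powRN opprB.
  rewrite !pE lef_pV2 ?posrE ?powR_gt0//; last by lra.
  by apply: ge0_ler_powR; rewrite ?nnegrE; lra.
have sle : sinc (r * (2 / T)) ^+ 2 <= 4^-1.
  have r2 : 2 <= r * (2 / T) by rewrite mulrA ler_pdivlMr// mulrC ler_wpM2r.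
  rewrite sincE; last by rewrite gt_eqF//; lra.
  rewrite expr_div_n ler_pdivrMr; last by rewrite exprn_gt0//; lra.
  (* The squared sine is at most 1, which is at most a quarter of the squared argument, the argument
     being at least 2. *)
  apply: (@le_trans _ _ 1); last by nra.
  by rewrite sin2cos2 gerBl sqr_ge0.
rewrite planar_integrand10// /c.
have s0 := sqr_ge0 (sin r); have z0 := powR_ge0 r (p - 3).
(* The target is a linear consequence of these two nonnegative products, so [lra] can finish. *)
have := mulr_ge0 s0 (_ : 0 <= r `^ (p - 3) - (T + T) `^ (p - 3)).
have := mulr_ge0 (mulr_ge0 s0 z0) (_ : 0 <= 4^-1 - sinc (r * (2 / T)) ^+ 2).
by rewrite !subr_ge0 => /(_ sle) + /(_ cr); lra.
Qed.

End Planar.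

(** * The section of the body by the plane of the first two axes *)

Section PlanarSection.
Context {R : realType}.
Variables (p : R) (m : nat).
Local Notation n := m.+2.
Implicit Types a b c t u : R.

Definition planar a b : 'rV[R]_n :=
  \row_(i < n) (if i == 0%N :> nat then a else if i == 1%N :> nat then b else 0).

Lemma planarZ c a b : c *: planar a b = planar (c * a) (c * b).
Proof. by apply/rowP => i; rewrite !mxE; do 2 case: ifP => // _; rewrite mulr0. Qed.

Lemma planarD a b a' b' : planar a b + planar a' b' = planar (a + a') (b + b').
Proof. by apply/rowP => i; rewrite !mxE; do 2 case: ifP => // _; rewrite addr0. Qed.

Lemma unit_sphere_planar a b : a ^+ 2 + b ^+ 2 = 1 -> unit_sphere (planar a b).
Proof.
move=> ab; rewrite /unit_sphere/= /dotp !big_ord_recl !mxE/= big1 => [|i _].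
  by rewrite addr0 -!expr2 ab sqrtr1.
by rewrite !mxE/= mulr0.
Qed.

(** The factors 2 of the transform square to [(2^n)^2], and dividing by the volume [2^n] leaves
    [2^n]. Coordinates beyond the first two contribute [sinc 0 = 1]. *)
Lemma radial_cube_planar a b : 0 < p ->
  radial_Fourier_mean_body p (cube R n) (planar a b) =
  poweR ((p * 2 ^+ n)%:E * planar_integral p a b)%E p^-1.
Proof.
move=> p0; rewrite /radial_Fourier_mean_body; congr poweR.
rewrite volume_cube [fine _]/=.
under eq_integral => r _.
  rewrite fourier_cube planarZ.
  have -> : (ComplexField.Normc.normc (\prod_(i < n)
      (2 * sinc (planar (r * a) (r * b) ord0 i)))%:C%C ^+ 2 * r `^ (p - 1))%:E =
      (((2 ^+ n) ^+ 2)%:E * (planar_integrand p a b r)%:E)%E.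
    rewrite -EFinM; congr EFin.
    rewrite /= expr0n/= addr0 sqrtr_sqr real_normK ?num_real//.
    rewrite big_split/= prodr_const card_ord.
    rewrite !big_ord_recl !mxE/= big1 => [|i _]; last by rewrite !mxE sinc0.
    by rewrite /planar_integrand mulr1; ring.
  over.
rewrite ge0_integralZl//; last 2 first.
- by apply/measurable_EFinP/measurable_funTS; exact: measurable_planar_integrand.
- by move=> r _; rewrite lee_fin planar_integrand_ge0.
rewrite muleA -EFinM; congr (_%:E * _)%E.
by field; rewrite expf_neq0.
Qed.

(** The hypothesis says that [a] is the radius along the first axis; the symmetry of J gives the
    same radius along the second. *)
Lemma mem_cube_body_axes a : 0 < p -> 0 <= a ->
  (a `^ p)%:E = ((p * 2 ^+ n)%:E * planar_integral p 1 0)%E ->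
  Fourier_mean_body p (cube R n) (planar a 0) /\
  Fourier_mean_body p (cube R n) (planar 0 a).
Proof.
move=> p0 a0 aE.
have aEV : (a%:E = poweR ((p * 2 ^+ n)%:E * planar_integral p 1 0) p^-1)%E.
  by rewrite -aE poweR_EFin -powRrM mulfV ?gt_eqF// powRr1.
split.
  exists a, (planar 1 0); split => //.
  - by apply: unit_sphere_planar; ring.
  - by rewrite radial_cube_planar// -aEV.
  - by rewrite planarZ mulr1 mulr0.
exists a, (planar 0 1); split => //.
- by apply: unit_sphere_planar; ring.
- by rewrite radial_cube_planar// planar_integralC -aEV.
- by rewrite planarZ mulr1 mulr0.
Qed.

(** The unit vector [theta] is [(c / t)] times [(1, u)]. By homogeneity the bound on [t] by the
    radius at [theta] turns into one on [c] involving only the unnormalized direction [(1, u)]. *)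
Lemma mem_cube_body_planar c u : 0 < p -> 0 < c ->
  Fourier_mean_body p (cube R n) (planar c (c * u)) ->
  ((c `^ p)%:E <= (p * 2 ^+ n)%:E * planar_integral p 1 u)%E.
Proof.
move=> p0 c0 [t [theta [_ t0 tle xE]]].
(* Otherwise the first coordinate [c] would be 0. *)
have tn0 : t != 0.
  apply: contra_eq_neq xE => ->; rewrite scale0r; apply/eqP => /rowP/(_ ord0).
  by rewrite !mxE/= => c00; rewrite c00 ltxx in c0.
have tgt0 : 0 < t by rewrite lt_def tn0.
have thetaE : theta = planar (c / t * 1) (c / t * u).
  rewrite -[LHS]scale1r -(mulVf tn0) -scalerA -xE planarZ.
  by congr planar; field.
move: tle; rewrite thetaE radial_cube_planar// => tle.
have ct0 : 0 < c / t by rewrite divr_gt0.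
rewrite (planar_integralZ 1 u p0 ct0) muleCA.
have -> : c `^ p = (c / t) `^ p * t `^ p by rewrite -powRM ?ltW// divfK.
rewrite EFinM lee_pmul2l ?lte_fin ?powR_gt0//.
have K0 : (0 <= (p * 2 ^+ n)%:E * planar_integral p (c / t * 1) (c / t * u))%E.
  by rewrite mule_ge0 ?planar_integral_ge0// lee_fin mulr_ge0 ?exprn_ge0// ltW.
have := gt0_ler_poweR (ltW p0) _ _ tle.
rewrite !in_itv/= !leey poweR_ge0 lee_fin t0 => /(_ isT isT).
by rewrite -poweRrM mulVf ?gt_eqF// poweRe1.
Qed.

End PlanarSection.

(** * Choice of the scale at which the cusp beats the linear bound *)

Section Gap.
Context {R : realType}.

(* Multiplied by T, the right-hand side grows like T^(p-1). *)
Lemma gap_exceeds_linear (p j : R) : 1 < p < 2 -> 0 <= j ->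
  exists2 T : R, 2 <= T & 3 * (2 / T) * j < 3 / 16 * T * (T + T) `^ (p - 3).
Proof.
(* With [S = 2T], multiplying by [S] turns the goal into [12 j < 3/32 * S^(p-1)], that is
   [S^(p-1) > 128 j]; [S >= 4] ensures [T >= 2]. *)
move=> /andP[p1 p2] j0; pose M := 128 * j + 1.
have M0 : 0 < M by rewrite /M; lra.
pose S := Num.max 4 (M `^ (p - 1)^-1).
have S4 : 4 <= S by rewrite le_max lexx.
have S0 : 0 < S by lra.
have MS : M <= S `^ (p - 1).
  have -> : M = (M `^ (p - 1)^-1) `^ (p - 1).
    by rewrite -powRrM mulVf ?powRr1 ?ltW//; lra.
  apply: ge0_ler_powR; rewrite ?nnegrE ?powR_ge0//; try lra.
  by rewrite le_max lexx orbT.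
exists (S / 2); first lra.
rewrite (_ : S / 2 + S / 2 = S); last by field.
have SE : S `^ (p - 1) = S ^+ 2 * S `^ (p - 3).
  rewrite (_ : p - 1 = 2%:R + (p - 3)); last by ring.
  rewrite [LHS]powRD; last by apply/implyP => _; rewrite gt_eqF.
  by rewrite powR_mulrn ?ltW.
rewrite -subr_gt0 (_ : _ - _ = (3 / 32 * S ^+ 2 * S `^ (p - 3) - 12 * j) / S).
  by rewrite divr_gt0// -mulrA -SE; rewrite /M in MS; lra.
by field; lra.
Qed.

End Gap.

(** * The chord between two axis points leaves the body *)

Theorem theorem8 (R : realType) (p : R) (hp : 1 < p < 2)
    (n : nat) (hn : (2 <= n)%N) :
  ~ convex_set (Fourier_mean_body p (cube R n)).
Proof.
case: n hn => [//|[//|m]] _ cvx; have /andP[p1 p2] := hp.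
have p0 : 0 < p by lra.
pose K : R := p * 2 ^+ m.+2.
have K0 : 0 < K by rewrite mulr_gt0 ?exprn_gt0.
(* Finiteness on the axis passes to every smaller value, so the comparison can be carried out in the
   reals. *)
have J_fin u : (planar_integral p 1 u <= planar_integral p 1 0)%E ->
    planar_integral p 1 u \is a fin_num.
  move=> le; rewrite ge0_fin_numE ?planar_integral_ge0//.
  by rewrite (le_lt_trans le)// planar_integral10_lty.
have /J_fin/fineK J0E := lexx (planar_integral p 1 0).
set j0 := fine _ in J0E.
have j0_ge0 : 0 <= j0 by rewrite fine_ge0// planar_integral_ge0.
have [T T2 Tgap] := gap_exceeds_linear hp j0_ge0.
have gap := planar_integral_gap p2 T2.
have T0 : 0 < T by lra.
have gamma0 : 0 < 3 / 16 * T * (T + T) `^ (p - 3).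
  by rewrite mulr_gt0 ?powR_gt0//; lra.
pose u : R := 2 / T.
have u0 : 0 < u by rewrite divr_gt0.
have u1 : u <= 1 by rewrite ler_pdivrMr// mul1r.
have /fineK JuE : planar_integral p 1 u \is a fin_num.
  by apply: J_fin; apply: le_trans gap; rewrite leeDl// lee_fin ltW.
move: gap; rewrite -/u -J0E -JuE -EFinD lee_fin; set j := fine _ => gap.
have j_ge0 : 0 <= j by rewrite fine_ge0// planar_integral_ge0.
have j0_gt0 : 0 < j0 by lra.
(* The common radius of the body along the first two axes. *)
pose a := (K * j0) `^ p^-1.
have a0 : 0 < a by rewrite powR_gt0// mulr_gt0.
have aE : a `^ p = K * j0.
  by rewrite -powRrM mulVf ?gt_eqF// powRr1// ltW// mulr_gt0.
have [mx my] : Fourier_mean_body p (cube R m.+2) (planar m a 0) /\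
    Fourier_mean_body p (cube R m.+2) (planar m 0 a).
  by apply: mem_cube_body_axes => //; [exact: ltW|rewrite aE -J0E].
(* The weight [1 / (1 + u)] makes the ratio of the two coordinates of the chord point equal to [u],
   so that this point lies in direction [(1, u)]. *)
have l01 : 0 <= (1 + u)^-1 <= 1.
  by rewrite invr_ge0 invf_le1 ?lerDl; [apply/andP; split|]; lra.
pose l : {i01 R} := Itv01 (proj1 (andP l01)) (proj2 (andP l01)).
have : Fourier_mean_body p (cube R m.+2)
    ((1 + u)^-1 *: planar m a 0 + (1 - (1 + u)^-1) *: planar m 0 a).
  by have := cvx (planar m a 0) (planar m 0 a) l; rewrite !inE; exact.
rewrite !planarZ planarD !mulr0 addr0 add0r.
pose c := (1 + u)^-1 * a.
rewrite (_ : (1 - (1 + u)^-1) * a = c * u); last by rewrite /c; field; lra.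
have c0 : 0 < c by rewrite mulr_gt0// invr_gt0; lra.
move=> /(mem_cube_body_planar p0 c0).
rewrite -/K -JuE -/j -EFinM lee_fin => cj.
(* Since [a = (1 + u) * c], the membership bound on [c^p] becomes the chord inequality J(1, 0) <= (1
   + u)^p J(1, u), up to the factor [K]. *)
have aj : K * j0 <= (1 + u) `^ p * (K * j).
  rewrite -aE (_ : a = (1 + u) * c); last by rewrite /c mulVKf//; lra.
  rewrite powRM ?ler_wpM2l ?powR_ge0//; first lra.
  exact: ltW.
(* Raise the exponent from [p] to 2, then use [u^2 <= u], valid as [u <= 1]. *)
have up : (1 + u) `^ p <= 1 + 3 * u.
  apply: (@le_trans _ _ ((1 + u) `^ 2%:R)).
    by apply: ler_powR; lra.
  by rewrite powR_mulrn; nra.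
have : j0 <= (1 + 3 * u) * j.
  by rewrite -(ler_pM2l K0) (le_trans aj)// mulrCA ler_pM2l// ler_wpM2r.
have jj0 : 3 * u * j <= 3 * u * j0.
  by rewrite ler_wpM2l//; [lra|lra].
(* Convexity yields [j0 - j <= 3 * u * j0], while the gap bounds [j0 - j] below by a quantity that
   [T] was chosen to make larger. *)
move: Tgap; rewrite -/u; lra.
Qed.
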